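(* Let $k_0\ge 3$ be an integer and $\lambda>0$. Consider the random walk on the growing complete graph with parameters $k_0$ and $\lambda$ (defined in the context), and for each integer $T\ge1$ let $N_T$ be the number of vertices visited at least once by the walker up to time $T$. Then, as $T\to\infty$, $$\frac{N_T}{T}\to\frac{\lambda}{1+\lambda}\quad\text{almost surely.}$$
   Context: Model (random walk on the growing complete graph). At time $0$ there are $k_0\ge 3$ vertices $v_1,\dots,v_{k_0}$ forming a complete graph, and a walker sits at one of these vertices (fixed). For each $t\in\{1,2,\dots\}$, a new vertex $v_{k_0+t}$ is created at time $t$ and joined to all present vertices; thus during the time interval $[t-1,t)$ the graph is the complete graph on $v_1,\dots,v_{k_0+t-1}$. The walker moves at random times: the times between successive moves (and up to the first move) are i.i.d. exponential with mean $1/\lambda$, so the move times form a Poisson process of rate $\lambda$; in particular the numbers $M_t$ of moves in $[t-1,t)$, $t\ge1$, are independent Poisson random variables with parameter $\lambda$. At each move the walker jumps to a vertex chosen uniformly at random among the vertices present at that time other than her current vertex, independently of the move times and of the past given her current position. The starting vertex counts as visited. *)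

(* Defs.v *)
From HB Require Import structures.
From mathcomp Require Import all_boot all_order all_algebra finmap.
From mathcomp Require Import all_classical all_reals all_analysis.

Set Implicit Arguments.
Unset Strict Implicit.
Unset Printing Implicit Defensive.

Import Order.TTheory GRing.Theory Num.Theory.
Import numFieldNormedType.Exports.

Local Open Scope classical_set_scope.
Local Open Scope ring_scope.

(* Vertices are natural numbers: v_1, v_2, ... are encoded as 0, 1, ..., so the
   vertices present at time s >= 0, when k0 + floor(s) of them have been
   created, are exactly the v < nb_present k0 s. *)
Definition nb_present (R : realType) (k0 : nat) (s : R) : nat :=
  (k0 + Num.truncn s)%N.

(* The uniform law on the neighbours of x in the complete graph on the k
   vertices 0, ..., k - 1, as a mass function of y (for x < k). *)
Definition uniform_neighbour (R : realType) (k x y : nat) : R :=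
  if (y < k)%N && (y != x) then (k.-1)%:R^-1 else 0.

Definition independent_RVs (d : measure_display) (Omega : measurableType d)
    (R : realType) (P : probability Omega R) (tau : nat -> {RV P >-> R}) : Prop :=
  forall (J : {fset nat}) (B : nat -> set R), (forall i, measurable (B i)) ->
    P (\bigcap_(i in [set` J]) (tau i @^-1` B i)) =
    (\prod_(i <- J) P (tau i @^-1` B i))%E.

(* tau i is the waiting time between moves number i and i + 1 (up to the first
   move for i = 0); move number n takes place at time move_time tau n, with
   move_time tau 0 = 0 standing for the start. *)
Definition move_time (Omega : Type) (R : realType) (tau : nat -> Omega -> R)
  (n : nat) (w : Omega) : R := \sum_(i < n) tau i w.

(* The sigma-algebra generated by all waiting times, past and future, and by
   the positions X 0, ..., X n. *)
Definition clock_and_past (Omega : Type) (R : realType)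
    (tau : nat -> Omega -> R) (X : nat -> Omega -> nat) (n : nat) :
    set (set Omega) :=
  <<s [set E | (exists i (B : set R), measurable B /\ E = tau i @^-1` B) \/
               (exists j (C : set nat), (j <= n)%N /\ E = X j @^-1` C)] >>.

(* X n is the position of the walker just after her n-th move.  The field
   gw_jump says that, conditionally on the sigma-algebra clock_and_past tau X n,
   X n.+1 is uniform on the vertices other than X n that are present at the time
   of move number n + 1 (defining property of a conditional probability). *)
Record growing_walk (d : measure_display) (Omega : measurableType d)
    (R : realType) (P : probability Omega R) (k0 : nat) (lambda : R) (x0 : nat)
    (tau : nat -> {RV P >-> R}) (X : nat -> {RV P >-> nat}) : Prop :=
  GrowingWalk {
    gw_exponential : forall i (B : set R), measurable B ->
      distribution P (tau i) B = exponential_prob lambda B;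
    gw_independent : independent_RVs tau;
    gw_start_present : (x0 < k0)%N;
    gw_start : forall w, X 0%N w = x0;
    gw_jump : forall (n y : nat) (E : set Omega), clock_and_past tau X n E ->
      P (E `&` X n.+1 @^-1` [set y]) =
      (\int[P]_(w in E)
         (uniform_neighbour R (nb_present k0 (move_time tau n.+1 w))
            (X n w) y)%:E)%E
  }.

Definition visited (Omega : Type) (R : realType) (tau : nat -> Omega -> R)
    (X : nat -> Omega -> nat) (T : nat) (w : Omega) : set nat :=
  [set v | exists n, move_time tau n w <= T%:R /\ X n w = v].

(* fset_set yields the empty set on infinite sets; this is harmless since the
   visited set is almost surely finite. *)
Definition nb_visited (Omega : Type) (R : realType) (tau : nat -> Omega -> R)
    (X : nat -> Omega -> nat) (T : nat) (w : Omega) : nat :=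
  #|` fset_set (visited tau X T w)|.

(* Main.v *)
Require Import Defs.
From HB Require Import structures.
From mathcomp Require Import all_boot all_order all_algebra finmap.
From mathcomp Require Import all_classical all_reals all_analysis.
From mathcomp Require Import measurable_realfun ring lra zify.

Set Implicit Arguments.
Unset Strict Implicit.
Unset Printing Implicit Defensive.

Import Order.TTheory GRing.Theory Num.Theory.
Import numFieldNormedType.Exports.

Local Open Scope classical_set_scope.
Local Open Scope ring_scope.

(** Let [S n] be the time of the n-th move, [K n] the number of vertices present
    then, and [D n] the number of distinct vertices visited by the first [n]
    moves.  Given the clock and the past, move [n.+1] hits an already visited
    vertex with probability [(D n - 1) / (K n.+1 - 1)].  The differences between
    the indicators of these returns and their conditional probabilities are
    bounded and orthogonal, so their averages tend to 0 almost surely; by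
    orthogonality again [S n / n] tends to [1 / lambda], hence so does [K n / n].
    On such a trajectory [D n.+1 - D n] is [1 - lambda * D n / n] up to terms of
    vanishing average, which forces [D n / n --> c] with [c = 1 - lambda * c].
    Finally the number of moves up to time [T] is equivalent to [lambda * T]. *)

(** * Deterministic limits of averages *)

(** A nondecreasing sequence lies between its values at the two squares around each index, and the
    ratio of consecutive squares tends to 1. *)
Lemma cvg_mean_of_squares (R : realType) (a : R^nat) (l : R) :
  (forall n, 0 <= a n) -> {homo a : m n / (m <= n)%N >-> m <= n} ->
  (a (k.+1 ^ 2)%N / (k.+1 ^ 2)%:R) @[k --> \oo] --> l ->
  a n / n%:R @[n --> \oo] --> l.
Proof.
move=> a0 ha al.
have ex (n : nat) : exists k, (k.+1 ^ 2 <= n.+1 < k.+2 ^ 2)%N.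
  elim: n => [|n [k /andP[k1 k2]]]; first by exists 0%N.
  have [h|h] := ltnP n.+2 (k.+2 ^ 2); first by exists k; rewrite (leq_trans k1).
  by exists k.+1; rewrite h /= (leq_ltn_trans k2)// ltn_exp2r.
have /choice[s sP] := ex.
have soo : s n @[n --> \oo] --> \oo.
  apply/cvgnyPge => A; near=> n.
  rewrite leqNgt; apply/negP => sA.
  have /andP[_ +] := sP n; rewrite ltnNge => /negP; apply.
  have : (A.+1 ^ 2 <= n)%N by near: n; exact: nbhs_infty_ge.
  by move=> h; apply: leq_trans (leqW h); rewrite leq_exp2r.
have ne k : (k.+1%:R : R) != 0 by rewrite pnatr_eq0.
(* [r (s n) ^ 2] is the ratio, smaller over larger, of the two squares enclosing [n.+1]. *)
pose r (k : nat) : R := k.+1%:R / k.+2%:R.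
have r1 : r k @[k --> \oo] --> (1 : R).
  rewrite (_ : r = fun k => (1 : R) - harmonic k.+1); last first.
    apply/funext => k; rewrite /r /=.
    apply: (mulIf (ne k.+1)); rewrite divfK ?ne// mulrBl mulVf ?ne// mul1r.
    by rewrite -(natr1 k.+1) addrK.
  rewrite -[X in _ --> X]subr0; apply: cvgB; first exact: cvg_cst.
  by rewrite (cvg_shiftS (@harmonic R)); exact: cvg_harmonic.
pose b (k : nat) : R := a (k.+1 ^ 2)%N / (k.+1 ^ 2)%:R.
have bs : b (s n) @[n --> \oo] --> l by exact: cvg_comp soo al.
have bs1 : b (s n).+1 @[n --> \oo] --> l.
  apply: (cvg_comp _ (fun n => b n.+1) soo).
  by rewrite (cvg_shiftS b).
have rs : r (s n) @[n --> \oo] --> (1 : R) by exact: cvg_comp soo r1.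
have rr : r (s n) * r (s n) @[n --> \oo] --> (1 : R).
  by rewrite -(mulr1 1); exact: cvgM.
rewrite -(cvg_shiftS (fun n => a n / n%:R)) /=.
apply: (@squeeze_cvgr _ _ _ _ (fun n => b (s n) * (r (s n) * r (s n)))
  (fun n => b (s n).+1 / (r (s n) * r (s n)))).
- near=> n; have /andP[h1 h2] := sP n; apply/andP; split.
  + rewrite (_ : _ * _ = a ((s n).+1 ^ 2)%N / ((s n).+2 ^ 2)%:R); last first.
      by rewrite /b /r !natrX; move: ((s n).+1%:R) ((s n).+2%:R)
        (ne (s n)) (ne (s n).+1) => x y x0 y0; field; rewrite ?x0 ?y0.
    apply: ler_pM => //; first exact: ha.
    by rewrite lef_pV2 ?posrE ?ltr0n ?expn_gt0// ler_nat ltnW.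
  + rewrite (_ : b _ / _ = a ((s n).+2 ^ 2)%N / ((s n).+1 ^ 2)%:R); last first.
      by rewrite /b /r !natrX; move: ((s n).+1%:R) ((s n).+2%:R)
        (ne (s n)) (ne (s n).+1) => x y x0 y0; field; rewrite ?x0 ?y0.
    apply: ler_pM => //; first exact/ha/ltnW.
    by rewrite lef_pV2 ?posrE ?ltr0n ?expn_gt0// ler_nat.
- by rewrite -(mulr1 l); exact: cvgM.
- by rewrite -(divr1 l); apply: cvgM => //; apply: cvgV => //; exact: oner_neq0.
Unshelve. all: by end_near. Qed.

(** Once [e] is below [eps / 2], each step adds at most [eps / 2] to [v], and the fixed value
    reached by then is eventually below [n * eps / 2]. *)
Lemma cvg_mean_of_increments (R : realType) (v e : R^nat) :
  (forall n, 0 <= v n) -> (forall n, v n.+1 <= v n + e n) ->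
  e n @[n --> \oo] --> 0 -> v n / n%:R @[n --> \oo] --> 0.
Proof.
move=> v0 ve e0; apply/cvgrPdist_le => eps eps0.
have e2 : 0 < eps / 2 by rewrite divr_gt0.
have [N _ NP] : \forall n \near \oo, `|0 - e n| <= eps / 2.
  by move/cvgrPdist_le : e0; apply.
have vN n : v (N + n)%N <= v N + n%:R * (eps / 2).
  elim: n => [|n ih]; first by rewrite addn0 mul0r addr0.
  rewrite addnS (le_trans (ve _))//.
  have /= := NP (N + n)%N (leq_addr _ _).
  rewrite sub0r normrN => /(le_trans (ler_norm _)) h.
  by rewrite -natr1 mulrDl mul1r addrA lerD.
near=> n.
rewrite sub0r normrN ger0_norm ?divr_ge0//.
have n0 : (0 < n)%N by near: n; exact: nbhs_infty_gt.
have nN : (N <= n)%N by near: n; exact: nbhs_infty_ge.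
rewrite ler_pdivrMr ?ltr0n//.
have := vN (n - N)%N; rewrite subnKC// natrB// => /le_trans; apply.
have : v N / (eps / 2) <= n%:R.
  by near: n; exact: nbhs_infty_ger.
rewrite ler_pdivrMr// => h.
have h' : 0 <= N%:R * (eps / 2) by rewrite mulr_ge0 ?ler0n// ltW.
rewrite mulrBl; lra.
Unshelve. all: by end_near. Qed.

(** Here [D] stands for the number of distinct vertices, [k] for the number of possible targets of a
    jump and [M] for the accumulated defects. The corrected deviation [f] of [D n] from [c * n]
    obeys a recursion with factor in [0, 1] and a forcing term tending to 0, so [f n / n] tends to
    0. *)
Lemma cvg_coverage (R : realType) (D k M : R^nat) (lambda : R) :
  0 < lambda -> (forall n, 1 <= k n) ->
  n%:R / k n @[n --> \oo] --> lambda ->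
  M n / n%:R @[n --> \oo] --> 0 ->
  (forall n, D n.+1 = D n + 1 - (D n - 1) / k n - (M n.+1 - M n)) ->
  D n / n%:R @[n --> \oo] --> (1 + lambda)^-1.
Proof.
move=> l0 k1 kl M0 DE.
pose c : R := (1 + lambda)^-1.
have lc : 1 - c - lambda * c = 0.
  by rewrite /c; field; rewrite gt_eqF// addr_gt0.
(* Adding [M n] cancels the defect increments in the recursion for [D]. *)
pose f n := D n - c * n%:R + M n.
pose b (n : nat) : R := 1 - c - n%:R / k n * c + (n%:R / k n) * (M n / n%:R)
  + (n%:R / k n) * n%:R^-1.
have k0 n : k n != 0 by rewrite gt_eqF// (lt_le_trans ltr01).
(* Indices start at [n.+1]: at 0 the quotients by [n] in [b] would be 0 by convention. *)
have fE n : f n.+2 = (1 - (k n.+1)^-1) * f n.+1 + b n.+1.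
  have : (n.+1%:R : R) != 0 by rewrite pnatr_eq0.
  rewrite /f /b DE -(natr1 n.+1); move: (n.+1%:R) (k n.+1) (k0 n.+1).
  by move=> x y y0 x0; field; rewrite ?x0 ?y0.
have n10 : n%:R^-1 @[n --> \oo] --> (0 : R).
  rewrite -(cvg_shiftS (fun n => n%:R^-1 : R)); exact: cvg_harmonic.
have b0 : b n @[n --> \oo] --> 0.
  rewrite (_ : 0 = 1 - c - lambda * c + lambda * 0 + lambda * 0); last first.
    by rewrite lc !mulr0 !addr0.
  apply: cvgD; last exact: cvgM.
  apply: cvgD; last exact: cvgM.
  apply: cvgB; first exact: cvg_cst.
  by apply: cvgM kl _; exact: cvg_cst.
have fl : `|f n.+1| / n%:R @[n --> \oo] --> 0.
  apply: (@cvg_mean_of_increments _ _ (fun n => `|b n.+1|)) => //.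
  - move=> n; rewrite fE (le_trans (ler_normD _ _))// lerD2r normrM.
    rewrite ler_piMl// ger0_norm ?subr_ge0 ?invf_le1 ?(lt_le_trans ltr01)//.
    by rewrite gerBl invr_ge0 (le_trans ler01).
  - by rewrite (cvg_shiftS (fun n => `|b n|)); apply/norm_cvg0P.
have fl' : f n / n%:R @[n --> \oo] --> 0.
  apply/norm_cvg0P; rewrite -(cvg_shiftS (fun n => `|f n / n%:R|)) /=.
  apply: (@squeeze_cvgr _ _ _ _ (cst 0) (fun n => `|f n.+1| / n%:R)) => //.
    near=> n; rewrite normr_ge0/= normrM ler_wpM2l//.
    have n0 : (0 < n)%N by near: n; exact: nbhs_infty_gt.
    by rewrite ger0_norm ?invr_ge0// lef_pV2 ?posrE ?ltr0n// ler_nat.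
  exact: cvg_cst.
rewrite (_ : (1 + lambda)^-1 = 0 + c - 0); last by rewrite subr0 add0r.
have H : f n / n%:R + c - M n / n%:R @[n --> \oo] --> 0 + c - 0.
  by apply: cvgB => //; apply: cvgD => //; exact: cvg_cst.
apply: cvg_trans H; apply: near_eq_cvg; near=> n.
have n0 : (0 < n)%N by near: n; exact: nbhs_infty_gt.
have : (n%:R : R) != 0 by rewrite pnatr_eq0 -lt0n.
by rewrite /f; move: (n%:R) => x x0; field.
Unshelve. all: by end_near. Qed.

Lemma cvg_mean_shiftS (R : realType) (S : R^nat) (l : R) :
  S n / n%:R @[n --> \oo] --> l -> S n.+1 / n%:R @[n --> \oo] --> l.
Proof.
move=> Sl.
have H : S n.+1 / n.+1%:R * (1 + n%:R^-1) @[n --> \oo] --> l * (1 + 0).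
  apply: cvgM; first by rewrite (cvg_shiftS (fun n => S n / n%:R)).
  apply: cvgD; first exact: cvg_cst.
  rewrite -(cvg_shiftS (fun n => n%:R^-1 : R)); exact: cvg_harmonic.
rewrite addr0 mulr1 in H.
apply: cvg_trans H; apply: near_eq_cvg; near=> n.
have n0 : (0 < n)%N by near: n; exact: nbhs_infty_gt.
have n1 : (n.+1%:R : R) != 0 by rewrite pnatr_eq0.
have n2 : (n%:R : R) != 0 by rewrite pnatr_eq0 -lt0n.
by move: n1 n2; rewrite -natr1; move: (n%:R) => x x1 x0; field; rewrite ?x0.
Unshelve. all: by end_near. Qed.

(** [T / m T] is squeezed between [S (m T) / m T] and [S (m T).+1 / m T], which share the limit
    [a^-1]; then [D (m T) / T] factors through [m T]. *)
Lemma cvg_inverse_index (R : realType) (S D : R^nat) (m : nat -> nat) (a c : R) :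
  0 < a -> {homo S : i j / (i <= j)%N >-> i <= j} ->
  S n / n%:R @[n --> \oo] --> a^-1 -> D n / n%:R @[n --> \oo] --> c ->
  (forall T, S (m T) <= T%:R < S (m T).+1) ->
  D (m T) / T%:R @[T --> \oo] --> a * c.
Proof.
move=> a0 hS Sa Dc mP.
have moo : m T @[T --> \oo] --> \oo.
  apply/cvgnyPge => A; near=> T.
  rewrite leqNgt; apply/negP => mA.
  have /andP[_ +] := mP T; rewrite ltNge => /negP; apply.
  apply: (le_trans (hS _ _ mA)).
  by near: T; exact: nbhs_infty_ger.
have S1a := cvg_mean_shiftS Sa.
have Tm : T%:R / (m T)%:R @[T --> \oo] --> a^-1.
  apply: (@squeeze_cvgr _ _ _ _ (fun T => S (m T) / (m T)%:R)
    (fun T => S (m T).+1 / (m T)%:R)).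
  - near=> T; have /andP[h1 h2] := mP T.
    by rewrite !ler_wpM2r ?invr_ge0 ?ler0n// ltW.
  - exact: (cvg_comp _ _ moo Sa).
  - exact: (cvg_comp _ _ moo S1a).
have H : (T%:R / (m T)%:R)^-1 * (D (m T) / (m T)%:R) @[T --> \oo] --> a * c.
  apply: cvgM; last exact: (cvg_comp _ _ moo Dc).
  by rewrite -[a]invrK; apply: cvgV => //; rewrite invr_eq0 gt_eqF.
apply: cvg_trans H; apply: near_eq_cvg; near=> T.
have T0 : (0 < T)%N by near: T; exact: nbhs_infty_gt.
have m0 : (0 < m T)%N.
  by near: T; move/cvgnyPgt : moo; apply.
have : (T%:R : R) != 0 by rewrite pnatr_eq0 -lt0n.
have : ((m T)%:R : R) != 0 by rewrite pnatr_eq0 -lt0n.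
by move: (T%:R) ((m T)%:R) => x y y0 x0; field; rewrite ?x0 ?y0.
Unshelve. all: by end_near. Qed.

(** * Strong law for orthogonal variables bounded below *)

(** Telescoping: the term with denominator [(n + 1)^2] is at most [1 / n - 1 / (n + 1)], so a
    nonempty sum of [n] terms is at most [2 - 1 / n]. *)
Lemma sum_inv_sqr_le (R : realFieldType) (n : nat) :
  \sum_(k < n) ((k.+1 ^ 2)%:R)^-1 <= 2 :> R.
Proof.
have [->|] := posnP n; first by rewrite big_ord0.
case: n => // n _; apply: (@le_trans _ _ (2 - n.+1%:R^-1)); last first.
  by rewrite gerBl invr_ge0.
elim: n => [|n ih]; first by rewrite big_ord1 /= exp1n invr1; lra.
rewrite big_ord_recr /= (le_trans (lerD ih (lexx _)))//.
have n1 : (0 : R) < n.+1%:R by rewrite ltr0n.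
rewrite natrX -(natr1 n.+1); move: (n.+1%:R) n1 => x x0.
have x1 : 0 < x + 1 by lra.
suff : ((x + 1) ^+ 2)^-1 <= x^-1 - (x + 1)^-1 by lra.
have -> : x^-1 - (x + 1)^-1 = (x * (x + 1))^-1 by field; rewrite !gt_eqF.
rewrite lef_pV2 ?posrE ?mulr_gt0 ?exprn_gt0//.
by rewrite expr2 ler_wpM2r// ltW//; lra.
Qed.

(** Each term is at most the tail of the series starting at it. *)
Lemma cvg_nneseries_terms (R : realType) (u : R^nat) :
  (forall k, 0 <= u k) -> (\sum_(k <oo) (u k)%:E < +oo)%E ->
  u k @[k --> \oo] --> 0.
Proof.
move=> u0 uoo.
have : (\sum_(N <= k <oo) (u k)%:E)%E @[N --> \oo] --> 0%E.
  by apply: nneseries_tail_cvg => // k _; rewrite lee_fin.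
move=> h.
have : (u k)%:E @[k --> \oo] --> 0%E.
  apply: (@squeeze_cvge _ _ _ _ (cst 0%E) _
    (fun N => (\sum_(N <= k <oo) (u k)%:E)%E)) => //; last exact: cvg_cst.
  apply: nearW => N; rewrite lee_fin u0/=.
  rewrite -[leLHS](@big_nat1 _ _ +%E N (fun k => (u k)%:E)).
  by apply: nneseries_lim_ge => k _ _; rewrite lee_fin.
exact: fine_cvg.
Qed.

Section orthogonal.
Context d (T : measurableType d) (R : realType) (P : probability T R).
Local Open Scope ereal_scope.

(** Each partial sum is orthogonal to the next variable, so expanding the square of the next sum
    adds only one second moment. *)
Lemma expectation_sqr_sum_le (Y : nat -> T -> R) (C : R) :
  (forall n, Y n \in Lfun P 2%:E) ->
  (forall i j, (i < j)%N -> 'E_P[Y i \* Y j] = 0) ->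
  (forall n, 'E_P[Y n \* Y n] <= C%:E) ->
  forall n, 'E_P[(\sum_(i < n) Y i)%R \* (\sum_(i < n) Y i)%R] <= (n%:R * C)%:E.
Proof.
move=> Y2 Y0 YC.
have S2 n : (\sum_(i < n) Y i)%R \in Lfun P 2%:E.
  by apply: rpred_sum => //; exact: lee1n.
have SY m n : (m <= n)%N -> 'E_P[(\sum_(i < m) Y i)%R \* Y n] = 0.
  elim: m => [_|m ih mn].
    rewrite big_ord0 (_ : (_ \* _)%R = cst 0%R) ?expectation_cst//.
    by apply/funext => w /=; rewrite mul0r.
  rewrite big_ord_recr/=.
  rewrite (_ : (_ \* _)%R = ((\sum_(i < m) Y i)%R \* Y n) \+ (Y m \* Y n))%R; last first.
    by apply/funext => w /=; rewrite mulrDl.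
  rewrite expectationD; [|exact: Lfun2_mul_Lfun1..].
  by rewrite ih ?Y0 ?adde0// ltnW.
elim=> [|n ih].
  rewrite big_ord0 (_ : (_ \* _)%R = cst 0%R) ?expectation_cst ?mul0r//.
  by apply/funext => w /=; rewrite mul0r.
rewrite big_ord_recr/=.
set S := (\sum_(i < n) Y i)%R.
rewrite (_ : (_ \* _)%R = ((S \* S) \+ (2 \o* (S \* Y n))) \+ (Y n \* Y n))%R; last first.
  by apply/funext => w /=; rewrite /= !fctE; ring.
have SS := Lfun2_mul_Lfun1 (S2 n) (S2 n).
have SYn := Lfun2_mul_Lfun1 (S2 n) (Y2 n).
rewrite expectationD; [|by rewrite rpredD// Lfun_scale|exact: Lfun2_mul_Lfun1].
rewrite expectationD//; last exact: Lfun_scale.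
by rewrite expectationZl// SY// mule0 adde0 -natr1 mulrDl mul1r EFinD leeD.
Qed.

End orthogonal.

Section strong_law.
Context d (T : measurableType d) (R : realType) (P : probability T R).

(** Along squares the second moments of the averages are at most [C / (k + 1)^2], hence summable,
    which gives almost sure convergence on this subsequence. The lower bound [- c] makes the sums of
    [Y i + c] monotone, so the other indices follow by [cvg_mean_of_squares]. *)
Lemma ae_cvg_mean_orthogonal (Y : nat -> T -> R) (C c : R) :
  (forall n, Y n \in Lfun P 2%:E) ->
  (forall i j, (i < j)%N -> ('E_P[Y i \* Y j] = 0)%E) ->
  (forall n, ('E_P[Y n \* Y n] <= C%:E)%E) ->
  0 <= c -> (forall n w, - c <= Y n w) ->
  {ae P, forall w,
    (\sum_(i < n) Y i w) / n%:R @[n --> \oo] --> (0 : R)}.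
Proof.
move=> Y2 Y0 YC c0 Yc.
have C0 : (0 <= C)%R.
  rewrite -lee_fin (le_trans _ (YC 0%N))// expectation_ge0// => w /=.
  by rewrite -expr2 sqr_ge0.
have mY n : measurable_fun setT (Y n).
  by have := Y2 n; rewrite inE => /andP[+ _]; rewrite inE.
pose q k := (k.+1 ^ 2)%N.
pose f k w : R := ((\sum_(i < q k) Y i w) / (q k)%:R) ^+ 2.
have f0 k w : (0 <= f k w)%R by exact: sqr_ge0.
have mf k : measurable_fun setT (f k).
  apply: measurable_funX; apply: measurable_funM => //.
  exact: measurable_sum.
have fC k : (\int[P]_w (f k w)%:E <= (C * (q k)%:R^-1)%:E)%E.
  have q0 : (q k)%:R != 0 :> R by rewrite pnatr_eq0 expn_eq0.
  have -> : (\int[P]_w (f k w)%:E = ((q k)%:R ^- 2)%:E *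
      'E_P[(\sum_(i < q k) Y i)%R \* (\sum_(i < q k) Y i)%R])%E.
    rewrite unlock -ge0_integralZl//=.
    - apply: eq_integral => w _; rewrite -EFinM; congr EFin.
      by rewrite /f fct_sumE; field.
    - apply/measurable_EFinP; apply: measurable_funM;
        rewrite fct_sumE; exact: measurable_sum.
    - by move=> w _; rewrite lee_fin -expr2 sqr_ge0.
  apply: (@le_trans _ _ (((q k)%:R ^- 2)%:E * ((q k)%:R * C)%:E)%E).
    apply: lee_pmul => //.
      by apply: expectation_ge0 => w /=; rewrite -expr2 sqr_ge0.
    exact: expectation_sqr_sum_le.
  by rewrite -EFinM lee_fin le_eqVlt; apply/orP; left; apply/eqP; field.
(* By Tonelli the series of squared averages has expectation at most [2 * C], so it is almost surely
   finite. *)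
have sumoo : (\int[P]_w (\sum_(k <oo) (f k w)%:E) < +oo)%E.
  rewrite integral_nneseries//=; last first.
  - by move=> k w _; rewrite lee_fin.
  - by move=> k; exact/measurable_EFinP.
  apply: (@le_lt_trans _ _ (C * 2)%:E); last exact: ltry.
  apply: lime_le; first by apply: is_cvg_nneseries => k _ _;
    apply: integral_ge0 => w _; rewrite lee_fin.
  apply: nearW => n; rewrite (le_trans (lee_sum _ (fun k _ => fC k)))//.
  rewrite sumEFin lee_fin -mulr_sumr ler_wpM2l// big_mkord.
  exact: sum_inv_sqr_le.
have : {ae P, forall w, (\sum_(k <oo) (f k w)%:E < +oo)%E}.
  have : P.-integrable setT (fun w => \sum_(k <oo) (f k w)%:E)%E.
    apply/integrableP; split.
      apply: ge0_emeasurable_sum => //; first by move=> k w _ _; rewrite lee_fin.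
      by move=> k _; exact/measurable_EFinP.
    rewrite (eq_integral (fun w => \sum_(k <oo) (f k w)%:E)%E)// => w _.
    by rewrite gee0_abs//; apply: nneseries_ge0 => k _ _; rewrite lee_fin.
  move=> /(integrable_ae measurableT); apply: filterS => w /(_ I).
  by rewrite fin_numElt => /andP[].
apply: filterS => w woo.
have fw0 : (f k w @[k --> \oo] --> (0 : R))%R by exact: cvg_nneseries_terms.
have Sq : (((\sum_(i < q k) Y i w) / (q k)%:R)%R @[k --> \oo] --> (0 : R)%R).
  apply/cvgrPdist_le => e e0.
  have e2 : (0 < e ^+ 2)%R by rewrite exprn_gt0.
  move/cvgrPdist_le : fw0 => /(_ _ e2); apply: filterS => k.
  rewrite !sub0r !normrN /f normrX => h.
  by rewrite -(@ler_pXn2r _ 2)// nnegrE ltW.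
pose a n := (\sum_(i < n) (Y i w + c))%R.
have aE n : a n = (\sum_(i < n) Y i w + n%:R * c)%R.
  by rewrite /a big_split/= sumr_const card_ord mulr_natl.
have al : ((a n / n%:R)%R @[n --> \oo] --> c).
  apply: cvg_mean_of_squares.
  - by move=> n; apply: sumr_ge0 => i _; rewrite -lerBlDr sub0r.
  - move=> m n /subnK <-; elim: (n - m)%N => [//|k ih].
    rewrite addSn /a big_ord_recr/= -/(a _) (le_trans ih)// lerDl.
    by rewrite -lerBlDr sub0r.
  - rewrite -[c]add0r.
    have H : ((\sum_(i < q k) Y i w) / (q k)%:R + c)%R @[k --> \oo] --> (0 + c)%R.
      by apply: cvgD => //; exact: cvg_cst.
    apply: cvg_trans H; apply: near_eq_cvg; apply: nearW => k /=.
    rewrite aE -/(q k).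
    have q0 : (q k)%:R != 0 :> R by rewrite pnatr_eq0 expn_eq0.
    by field.
have H : (a n / n%:R - c)%R @[n --> \oo] --> (c - c)%R.
  by apply: cvgB => //; exact: cvg_cst.
rewrite subrr in H; apply: cvg_trans H; apply: near_eq_cvg; near=> n.
have n0 : (n%:R : R) != 0.
  by rewrite pnatr_eq0 -lt0n; near: n; exact: nbhs_infty_gt.
by rewrite /= aE; field.
Unshelve. all: by end_near. Qed.

End strong_law.

(** * Tail and moments of the exponential law *)

(** An antiderivative is [- (1 + x)^-1]. The integrand reappears as the tail of [W] in
    [Lfun2_exponential]. *)
Lemma integral_inv_sqr_shift (R : realType) :
  (\int[lebesgue_measure]_(r in `[0%R, +oo[) ((1 + r) ^- 2)%:E = 1 :> \bar R)%E.
Proof.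
have dF (x : R) : 0 <= x ->
    is_derive x 1 (fun x : R => - (1 + x)^-1) ((1 + x) ^- 2).
  move=> x0; have x1 : 1 + x != 0 by rewrite gt_eqF// ltr_pwDl.
  have H : is_derive x 1 (cst 1 + id : R -> R) 1.
    by apply: is_derive_eq; rewrite add0r.
  have := is_deriveN (is_deriveV x1 H).
  by rewrite scaleNr opprK /GRing.scale/= mulr1.
rewrite (@ge0_continuous_FTC2y _ _ (fun x => - (1 + x)^-1) _ 0)//.
- by rewrite addr0 invr1 EFinN oppeK add0e.
- by move=> x x0; rewrite invr_ge0 exprn_ge0// addr_ge0.
- apply: continuous_in_subspaceT => x; rewrite inE/= in_itv/= andbT => x0.
  have x1 : 1 + x != 0 by rewrite gt_eqF// ltr_pwDl.
  apply: cvgV; first by rewrite expf_neq0.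
  have c1 : (1 + y)%R @[y --> x] --> 1 + x by apply: cvgD => //; exact: cvg_cst.
  by under eq_fun do rewrite expr2; rewrite expr2; exact: cvgM.
- rewrite -oppr0; apply: cvgN; apply/gtr0_cvgV0.
    near=> x; rewrite ltr_pwDl//; near: x; apply: nbhs_pinfty_ge; exact: num_real.
  apply/cvgryPge => A; near=> x.
  rewrite -lerBlDl; near: x; apply: nbhs_pinfty_ge; exact: num_real.
- by move=> x x0; have [] := dF x (ltW x0).
- apply: cvg_at_right_filter; apply: cvgN; apply: cvgV; rewrite ?addr0 ?oner_neq0//.
  by rewrite -[X in _ --> X]addr0; apply: cvgD => //; exact: cvg_cst.
- move=> x; rewrite in_itv/= andbT => x0.
  by rewrite derive1E; have [_ ->] := dF x (ltW x0).
Unshelve. all: by end_near. Qed.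

Section exponential_gt.
Context d (T : measurableType d) (R : realType) (P : probability T R).
Variables (lambda : R) (tau : {RV P >-> R}).
Hypothesis tau_exp : forall B, measurable B ->
  distribution P tau B = exponential_prob lambda B.

Lemma exponential_le0 : P (tau @^-1` `]-oo, 0]%classic) = 0%E.
Proof.
rewrite -[LHS]/(distribution P tau _) tau_exp// /exponential_prob.
(* The density is known to vanish strictly below 0, so the endpoint, a null set, is dropped
   first. *)
rewrite -integral_itv_bndo_bndc; last first.
  apply/measurable_EFinP; apply: measurable_funTS.
  exact: measurable_exponential_pdf.
apply: integral0_eq => x /=; rewrite in_itv/= => x0.
by rewrite lt0_exponential_pdf.
Qed.

Lemma exponential_gt (r : R) : 0 <= r ->
  P (tau @^-1` `]r, +oo[%classic) = (expR (- lambda * r))%:E.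
Proof.
move=> r0; pose m : probability R R := distribution P tau.
have m0 : m `]-oo, 0]%classic = 0%E := exponential_le0.
have mr : m `]-oo, r]%classic = (1 - (expR (- lambda * r))%:E)%E.
  move: r0; rewrite le_eqVlt => /predU1P[<-|r0].
    by rewrite m0 mulr0 expR0 subee.
  (* []-oo, r]] and [[0, r]] carry the same mass because []-oo, 0]] is null. *)
  rewrite -exponential_prob_itv0c// -tau_exp// -/m.
  apply/eqP; rewrite eq_le; apply/andP; split.
    apply: (@le_trans _ _ (m (`]-oo, 0]%classic `|` `[0, r]%classic))).
      apply: le_measure; rewrite ?inE//; first exact: measurableU.
      move=> x /=; rewrite !in_itv/= => xr.
      by have [x0|/ltW x0] := leP x 0; [left|right; rewrite x0].
    apply: (le_trans (measureU2 _ (measurable_itv _) (measurable_itv _))).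
    by rewrite -[leRHS]add0e leeD2r//; move: m0 => /eqP; rewrite eq_le => /andP[].
  by apply: le_measure; rewrite ?inE// => x /=; rewrite !in_itv/= => /andP[].
rewrite -[LHS]/(m _) -setCitvl probability_setC// mr oppeB ?fin_num_adde_defl//.
by rewrite addeA subee// add0e.
Qed.

End exponential_gt.

Section Lfun2.
Context d (T : measurableType d) (R : realType) (P : probability T R).

Lemma Lfun2_of_sqr (f : T -> R) : measurable_fun setT f ->
  (\int[P]_w (f w ^+ 2)%:E < +oo)%E -> f \in Lfun P 2%:E.
Proof.
move=> mf foo; rewrite inE; apply/andP; split; rewrite inE//=.
rewrite /finite_norm unlock poweR_lty//.
rewrite (eq_integral (fun w => (f w ^+ 2)%:E))// => w _ /=.
by rewrite powR_mulrn// real_normK ?num_real.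
Qed.

Lemma Lfun2_of_bounded (f : T -> R) (c : R) : measurable_fun setT f ->
  (forall w, `|f w| <= c) -> f \in Lfun P 2%:E.
Proof.
move=> mf fc; apply: Lfun2_of_sqr => //.
apply: (@le_lt_trans _ _ (\int[P]_w (c ^+ 2)%:E)%E).
  apply: ge0_le_integral => //.
  - by move=> w _; rewrite lee_fin sqr_ge0.
  - by apply/measurable_EFinP; exact: measurable_funX.
  - move=> w _; rewrite lee_fin -real_normK ?num_real//.
    by rewrite lerXn2r ?nnegrE// (le_trans _ (fc w)).
by rewrite integral_cst//= probability_setT mule1 ltry.
Qed.
End Lfun2.

Section exponential_moments.
Context d (T : measurableType d) (R : realType) (P : probability T R).
Variables (lambda : R) (tau : {RV P >-> R}).
Hypothesis lambda_gt0 : 0 < lambda.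
Hypothesis tau_exp : forall B, measurable B ->
  distribution P tau B = exponential_prob lambda B.

Let Z (w : T) : R := Num.max (tau w) 0.

Let measurable_Z : measurable_fun setT Z.
Proof. by apply: measurable_maxr => //; exact: measurable_funPT. Qed.

(* [tau] may be negative on a null set; the tail formula for expectations needs
   a variable that is nonnegative everywhere, hence the maximum with 0. *)
Lemma expectation_exponential :
  ('E_P[(fun w => Num.max (tau w) 0)%R] = (lambda^-1)%:E)%E.
Proof.
have Z0 w : 0 <= Z w by rewrite /Z le_max lexx orbT.
have := @ge0_expectation_ccdf _ _ _ P (mfun_Sub (mem_set measurable_Z)) Z0.
rewrite /= => ->.
transitivity (\int[lebesgue_measure]_(r in `[0%R, +oo[)
    (expR (- lambda * r))%:E)%E.
  apply: eq_integral => r; rewrite inE/= in_itv/= andbT => r0.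
  rewrite /ccdf -(exponential_gt tau_exp r0).
  congr (P _); apply/seteqP; split => w /=; rewrite !in_itv/= !andbT /Z lt_max.
    by move=> /orP[//|]; rewrite ltNge r0.
  by move=> ->.
(* The tail integral comes from the total mass 1 of the density, which is [lambda] times the
   tail. *)
have : (\int[lebesgue_measure]_(r in `[0%R, +oo[)
    (lambda * expR (- lambda * r))%:E = 1)%E.
  rewrite -(integral_exponential_pdf lambda_gt0) [LHS]integral_mkcond.
  apply: eq_integral => r _; rewrite /exponential_pdf /patch.
  by case: ifPn.
under eq_integral do rewrite EFinM.
rewrite ge0_integralZl//=; last 2 first.
- apply: measurable_funTS; apply/measurable_EFinP.
  by apply: measurableT_comp => //; exact: measurable_funM.
- by rewrite lee_fin ltW.
move=> h; rewrite -[LHS]mul1e.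
have -> : 1%E = ((lambda^-1)%:E * lambda%:E)%E.
  by rewrite -EFinM mulVf// gt_eqF.
by rewrite -muleA h mule1.
Qed.

Lemma Lfun2_exponential : (fun w => Num.max (tau w) 0) \in Lfun P 2%:E.
Proof.
have Z0 w : 0 <= Z w by rewrite /Z le_max lexx orbT.
(* [Z ^+ 2] is bounded by a multiple of [W], and [W > r] has probability
   [(1 + r) ^- 2]. *)
pose a := lambda / 2.
have a0 : 0 < a by rewrite divr_gt0.
pose W w : R := expR (a * Z w) - 1.
have mW : measurable_fun setT W.
  apply: measurable_funB => //; apply: measurableT_comp => //.
  exact: measurable_funM.
(* From the quadratic term of the exponential series: [1 + x ^ 2 / 2 <= expR x] for [x >= 0]. *)
have ZW w : Z w ^+ 2 <= 2 / a ^+ 2 * W w.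
  have := @expR_ge1Dxn _ (a * Z w) 1 (mulr_ge0 (ltW a0) (Z0 w)).
  rewrite exprMn -lerBrDl -/(W w) => h.
  rewrite -ler_pdivrMl ?divr_gt0 ?exprn_gt0// (le_trans _ h)//.
  by rewrite invf_div mulrAC.
have W0 w : 0 <= W w.
  by rewrite /W subr_ge0 -expR0 ler_expR mulr_ge0// ltW.
have EW : (\int[P]_w (W w)%:E = 1)%E.
  have := @ge0_expectation_ccdf _ _ _ P (mfun_Sub (mem_set mW)) W0.
  rewrite unlock /= => ->.
  rewrite -[RHS]integral_inv_sqr_shift; apply: eq_integral => r.
  rewrite inE/= in_itv/= andbT => r0.
  have r1 : 0 < 1 + r by rewrite ltr_pwDl.
  have lr : 0 <= a^-1 * ln (1 + r).
    by rewrite mulr_ge0 ?invr_ge0 ?ln_ge0 ?lerDl// ltW.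
  transitivity (P (tau @^-1` `](a^-1 * ln (1 + r)), +oo[%classic)).
    rewrite /ccdf; congr (P _); apply/seteqP; split => w /=;
      rewrite !in_itv/= !andbT /W ltrBrDl.
      rewrite -{1}(lnK r1) ltr_expR -ltr_pdivrMl// lt_max => /orP[//|].
      by rewrite ltNge lr.
    move=> h; rewrite -{1}(lnK r1) ltr_expR -ltr_pdivrMl//.
    by rewrite lt_max h.
  rewrite (exponential_gt tau_exp lr); congr EFin.
  (* With [a = lambda / 2] the exponent is [- 2 * ln (1 + r)], giving an integrable tail;
     [a = lambda] would give [(1 + r)^-1]. *)
  rewrite (_ : _ * _ = - (ln (1 + r) *+ 2)); last first.
    by rewrite /a; field; rewrite gt_eqF.
  by rewrite expRN -mulr_natr expRM_natr lnK.
apply: Lfun2_of_sqr => //.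
apply: (@le_lt_trans _ _ (\int[P]_w ((2 / a ^+ 2)%:E * (W w)%:E))%E).
  apply: ge0_le_integral => //.
  - by move=> w _; rewrite lee_fin sqr_ge0.
  - by apply/measurable_EFinP; exact: measurable_funX.
  - by apply/measurable_EFinP; apply: measurable_funM.
  - by move=> w _; rewrite -EFinM lee_fin; exact: ZW.
rewrite ge0_integralZl//=.
- by rewrite EW mule1 ltry.
- exact/measurable_EFinP.
- by move=> w _; rewrite lee_fin.
- by rewrite lee_fin divr_ge0// exprn_ge0// ltW.
Qed.

End exponential_moments.

(** * Law of large numbers for the move times *)

Section independent_clocks.
Context d (T : measurableType d) (R : realType) (P : probability T R).

(** The product rule on rectangles identifies the joint law of [U] and [V] with the product of their
    laws, and Tonelli separates the factors. *)
Lemma expectation_mul_independent (U V : {RV P >-> R}) (g h : R -> R) :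
  measurable_fun setT g -> measurable_fun setT h ->
  (forall x, 0 <= g x) -> (forall x, 0 <= h x) ->
  (forall A B, measurable A -> measurable B ->
    P (U @^-1` A `&` V @^-1` B) = (P (U @^-1` A) * P (V @^-1` B))%E) ->
  ('E_P[(g \o U) \* (h \o V)]%R = 'E_P[g \o U] * 'E_P[h \o V])%E.
Proof.
move=> mg mh g0 h0 UV; rewrite unlock.
pose m1 : probability _ R := distribution P U.
pose m2 : probability _ R := distribution P V.
pose W w := (U w, V w).
have mW : measurable_fun setT W by exact: measurable_fun_pair.
have mf1 : measurable_fun setT (fun z : R * R => (g z.1)%:E).
  by apply/measurable_EFinP; exact: measurableT_comp.
have mf2 : measurable_fun setT (fun z : R * R => (h z.2)%:E).
  by apply/measurable_EFinP; exact: measurableT_comp.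
have mf : measurable_fun setT (fun z : R * R => (g z.1 * h z.2)%:E).
  by apply/measurable_EFinP; apply: measurable_funM; exact: measurableT_comp.
transitivity (\int[pushforward P W]_z (g z.1 * h z.2)%:E)%E.
  rewrite ge0_integral_pushforward//= => z _.
  by rewrite lee_fin mulr_ge0.
transitivity (\int[m1 \x m2]_z (g z.1 * h z.2)%:E)%E.
  apply: eq_measure_integral => A mA _.
  exact/esym/product_measure_unique.
rewrite fubini_tonelli1//=; last by move=> z; rewrite lee_fin mulr_ge0.
have eqV : (\int[m2]_y (h y)%:E = \int[P]_w (h (V w))%:E)%E.
  by rewrite ge0_integral_distribution//; exact/measurable_EFinP.
have eqU : (\int[m1]_y (g y)%:E = \int[P]_w (g (U w))%:E)%E.
  by rewrite ge0_integral_distribution//; exact/measurable_EFinP.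
transitivity (\int[m1]_x ((g x)%:E * \int[m2]_y (h y)%:E))%E.
  apply: eq_integral => x _; rewrite -ge0_integralZl//.
  - exact/measurable_EFinP.
  - by move=> y _; rewrite lee_fin.
  - by rewrite lee_fin.
rewrite ge0_integralZr//.
- by rewrite eqU eqV.
- exact/measurable_EFinP.
- by move=> x _; rewrite lee_fin.
- by apply: integral_ge0 => y _; rewrite lee_fin.
Qed.

Variables (lambda : R) (tau : nat -> {RV P >-> R}).
Hypothesis lambda_gt0 : 0 < lambda.
Hypothesis tau_exp : forall i B, measurable B ->
  distribution P (tau i) B = exponential_prob lambda B.
Hypothesis tau_indep : independent_RVs tau.

Lemma independent_pair i j (A B : set R) : i != j ->
  measurable A -> measurable B ->
  P (tau i @^-1` A `&` tau j @^-1` B) =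
  (P (tau i @^-1` A) * P (tau j @^-1` B))%E.
Proof.
move=> ij mA mB.
pose C k := if k == i then A else B.
have mC k : measurable (C k) by rewrite /C; case: ifP.
have := tau_indep [fset i; j]%fset mC.
rewrite big_fsetU1/= ?inE// big_seq_fset1 /C eqxx eq_sym (negbTE ij) => <-.
congr (P _); apply/seteqP; split => w /=.
  move=> [Aw Bw] k /=; rewrite !inE => /orP[|] /eqP ->; first by rewrite eqxx.
  by rewrite eq_sym (negbTE ij).
move=> H; split.
  by have := H i; rewrite /= eqxx; apply; rewrite !inE eqxx.
have := H j; rewrite /= eq_sym (negbTE ij); apply.
by rewrite !inE eqxx orbT.
Qed.

Lemma ae_tau_gt0 : {ae P, forall w, forall i, 0 < tau i w}.
Proof.
apply: ae_foralln => i.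
have := exponential_le0 (tau_exp i) => h.
exists (tau i @^-1` `]-oo, 0]%classic); split => //.
- by rewrite -[_ @^-1` _]setTI; exact: measurable_funPT.
- by move=> w /= /negP; rewrite -leNgt in_itv.
Qed.

(** The centered positive parts [Y i] are orthogonal by pairwise independence, bounded below by
    [- lambda^-1], and share one second moment, so [ae_cvg_mean_orthogonal] applies. *)
Lemma ae_cvg_move_time :
  {ae P, forall w, (move_time tau n w / n%:R) @[n --> \oo] --> lambda^-1}.
Proof.
pose g (x : R) : R := Num.max x 0.
have mg : measurable_fun setT g by exact: measurable_maxr.
have g0 x : 0 <= g x by rewrite /g le_max lexx orbT.
pose Z i : T -> R := g \o tau i.
have Z2 i : Z i \in Lfun P 2%:E
  by exact: (Lfun2_exponential lambda_gt0 (@tau_exp i)).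
have Z1 i : Z i \in Lfun P 1.
  by apply: Lfun_subset12 => //; exact: fin_num_measure.
have EZ i : ('E_P[Z i] = (lambda^-1)%:E)%E.
  exact: (expectation_exponential lambda_gt0 (@tau_exp i)).
pose Y i : T -> R := Z i \- cst lambda^-1.
have Y2 i : Y i \in Lfun P 2%:E.
  apply: rpredB => //; first exact: lee1n.
  by move=> p1; exact: Lfun_cst.
have YY i j : ('E_P[Y i \* Y j] = covariance P (Z i) (Z j))%E.
  by rewrite [in RHS]unlock !EZ.
have Yc i w : - lambda^-1 <= Y i w by rewrite /Y/= lerBrDl subrr; exact: g0.
have Y0 i j : (i < j)%N -> 'E_P[Y i \* Y j]%E = 0%E.
  move=> ij; rewrite YY covarianceE//; last exact: Lfun2_mul_Lfun1.
  rewrite (_ : (Z i * Z j)%R = Z i \* Z j)//.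
  rewrite expectation_mul_independent// ?EZ ?subee//.
  by move=> A B mA mB; apply: independent_pair => //; rewrite ltn_eqF.
have YC i : 'E_P[Y i \* Y i]%E = 'E_P[Y 0%N \* Y 0%N]%E.
  rewrite unlock; pose f (x : R) : \bar R := ((g x - lambda^-1) ^+ 2)%:E.
  have mf : measurable_fun setT f.
    by apply/measurable_EFinP; apply: measurable_funX; exact: measurable_funB.
  have f0 x : (0 <= f x)%E by rewrite lee_fin sqr_ge0.
  have E k : (\int[P]_w (Y k w * Y k w)%:E =
              \int[distribution P (tau k)]_x f x)%E.
    rewrite ge0_integral_distribution//; exact: eq_integral.
  rewrite !E; apply: eq_measure_integral => A mA _.
  by apply: (@eq_trans _ _ (exponential_prob lambda A)); [|apply/esym];
    exact: tau_exp.
have Y01 := Lfun2_mul_Lfun1 (Y2 0%N) (Y2 0%N).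
have H := @ae_cvg_mean_orthogonal _ _ _ P Y
  (fine 'E_P[Y 0%N \* Y 0%N]%E) lambda^-1 Y2 Y0.
have {H} H : {ae P, forall w,
    (\sum_(i < n) Y i w) / n%:R @[n --> \oo] --> (0 : R)}.
  apply: H => //; last by rewrite invr_ge0 ltW.
  by move=> i; rewrite fineK ?YC// expectation_fin_num.
apply: filterS2 ae_tau_gt0 H => w tau0 Yw.
have H : (\sum_(i < n) Y i w) / n%:R + lambda^-1 @[n --> \oo] --> 0 + lambda^-1.
  by apply: cvgD => //; exact: cvg_cst.
rewrite add0r in H; apply: cvg_trans H; apply: near_eq_cvg; near=> n.
have n0 : (n%:R : R) != 0.
  by rewrite pnatr_eq0 -lt0n; near: n; exact: nbhs_infty_gt.
(* All waiting times are positive on this trajectory, so they equal their positive parts. *)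
have -> : move_time tau n w = \sum_(i < n) Y i w + n%:R * lambda^-1.
  rewrite -[n in n%:R]card_ord mulr_natl -sumr_const -big_split/=.
  apply: eq_bigr => i _; rewrite /Y /Z /= /g max_l ?subrK//; exact/ltW.
by rewrite mulrDl mulrAC divff// mul1r.
Unshelve. all: by end_near. Qed.

End independent_clocks.

(** * Countably valued maps and measurability of fibers *)

Section countable_valued.
Context d (T : measurableType d) (R : realType) (C : countType).
Variable H : T -> C.
Hypothesis mH : forall c, measurable [set w | H w = c].

(** Since [C] is countable, any preimage is a countable union of fibers of [H]. *)
Lemma measurable_fun_fibers d' (T' : measurableType d') (f : C -> T') :
  measurable_fun setT (f \o H).
Proof.
move=> _ B mB; rewrite setTI.
rewrite (_ : _ @^-1` B =
    \bigcup_(k in [set k : nat |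
        if @choice.unpickle C k is Some c then f c \in B else false])
      [set w | Some (H w) = choice.unpickle k]); last first.
  apply/seteqP; split => w /=.
    by move=> BHw; exists (choice.pickle (H w)); rewrite /= choice.pickleK// inE.
  by move=> [k /= +]; case: choice.unpickle => // c /[swap] -[->]; rewrite inE.
apply: bigcup_measurable => k _; case: choice.unpickle => [c|].
  rewrite (_ : [set w | _] = [set w | H w = c])//.
  by apply/seteqP; split => w /= => [[]|->].
by rewrite (_ : [set w | _] = set0)//; apply/seteqP; split.
Qed.

(** A concrete form of conditioning on [H]: on each fiber [f (H w)] is constant and leaves the
    integral, and countably many fibers cover the space. *)
Lemma integral_mul_fibers_eq0 (P : probability T R) (f : C -> R) (g : T -> R) :
  P.-integrable setT (EFin \o (fun w => f (H w) * g w)) ->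
  P.-integrable setT (EFin \o g) ->
  (forall c, (\int[P]_(w in [set w | H w = c]) (g w)%:E = 0)%E) ->
  (\int[P]_w (f (H w) * g w)%:E = 0)%E.
Proof.
move=> ifg ig g0.
(* Fibers are indexed by codes in [nat]; codes that are not reached give the empty set. *)
pose F k := [set w | choice.pickle (H w) = k].
have FE k : F k = set0 \/ exists c, F k = [set w | H w = c].
  have [[w Fw]|h] := pselect (exists w, F k w).
    right; exists (H w); apply/seteqP; split => v /=.
      by rewrite /F/= -Fw => /(pcan_inj choice.pickleK).
    by rewrite -Fw /F/= => ->.
  by left; apply/seteqP; split => w // Fw; apply: h; exists w.
have mF k : measurable (F k).
  by have [->|[c ->]] := FE k.
have UF : \bigcup_k F k = setT.
  by apply/seteqP; split => // w _; exists (choice.pickle (H w)).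
rewrite -UF integral_bigcup//; last 2 first.
  by move=> i j _ _ [w [<- <-]].
  by rewrite UF.
apply: eseries0 => k _ _.
have [->|[c Fc]] := FE k; first by rewrite integral_set0.
rewrite (eq_integral (fun w => (f c)%:E * (g w)%:E)%E); last first.
  by move=> w; rewrite inE Fc/= => <-.
rewrite Fc integralZl// ?g0 ?mule0//.
exact: integrableS ig.
Qed.

End countable_valued.

(** Measurability is asked of the entries below [n] only, which is what the sigma-algebra of the
    past offers for positions. *)
Lemma measurable_mkseq_fiber d (T : measurableType d) (F : nat -> T -> nat) n s :
  (forall i k, (i < n)%N -> measurable [set w | F i w = k]) ->
  measurable [set w | mkseq (F ^~ w) n = s].
Proof.
elim: n s => [|n ih] s mF.
  have [->|s0] := eqVneq s [::].
    by rewrite (_ : [set w | _] = setT)//; apply/seteqP; split.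
  rewrite (_ : [set w | _] = set0)//; apply/seteqP; split => w //= /esym/eqP.
  by rewrite (negbTE s0).
case: (lastP s) => [|{}s x].
  by rewrite (_ : [set w | _] = set0)//; apply/seteqP; split.
rewrite (_ : [set w | _] =
    [set w | mkseq (F ^~ w) n = s] `&` [set w | F n w = x]); last first.
  apply/seteqP; split => w /=; rewrite mkseqS; first by move/rcons_inj => [].
  by move=> [-> ->].
apply: measurableI; last exact: mF.
by apply: ih => i k /ltnW; exact: mF.
Qed.

Lemma measurable_nb_present d (T : measurableType d) (R : realType) (k0 k : nat)
    (g : T -> R) : measurable_fun setT g ->
  measurable [set w | nb_present k0 (g w) = k].
Proof.
move=> mg.
have mB j : measurable [set w | (j <= Num.truncn (g w))%N].
  (* For [j = 0] the set is everything, since negative reals also truncate to 0. *)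
  case: j => [|j].
    by rewrite (_ : [set w | _] = setT)//; apply/seteqP; split.
  rewrite (_ : [set w | _] = g @^-1` `[j.+1%:R, +oo[%classic).
    by rewrite -[_ @^-1` _]setTI; exact: mg.
  by apply/seteqP; split => w /=; rewrite in_itv/= andbT truncn_gt_nat.
have [kk|kk] := leqP k0 k.
  rewrite (_ : [set w | _] = [set w | (k - k0 <= Num.truncn (g w))%N] `\`
    [set w | ((k - k0).+1 <= Num.truncn (g w))%N]).
    exact: measurableD.
  by apply/seteqP; split => w /=; rewrite /nb_present; lia.
rewrite (_ : [set w | _] = set0)//; apply/seteqP; split => w //=.
by rewrite /nb_present; lia.
Qed.

(** * Return defects and histories *)

(* The indicator that a walker with past [s] jumps to an already visited vertex
   [y], centered by its conditional probability when [k] vertices are present;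
   written as a sum over the visited vertices so that each term can be integrated
   with gw_jump. *)
Definition return_defect (R : realType) (k : nat) (s : seq nat) (y : nat) : R :=
  \sum_(z <- undup s) ((y == z)%:R - uniform_neighbour R k (last 0%N s) z).

Lemma sum_eq_undup (R : realType) (s : seq nat) (y : nat) :
  \sum_(z <- undup s) (y == z)%:R = (y \in s)%:R :> R.
Proof.
rewrite -mem_undup; have := undup_uniq s; elim: (undup s) => [|z t ih] /=.
  by rewrite big_nil.
move=> /andP[zt ut]; rewrite big_cons ih// inE.
have [->|] := eqVneq y z; last by rewrite add0r.
by rewrite (negbTE zt) addr0.
Qed.

(** The masses are at most [(k - 1)^-1] on at most [k] vertices, so they add up to at most 2.
    Arbitrary lists [s] are covered, since positions are present only almost surely whereas the
    strong law wants a bound everywhere. *)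
Lemma return_defect_bounded (R : realType) (k : nat) (s : seq nat) (y : nat) :
  (3 <= k)%N -> `|return_defect R k s y| <= 2.
Proof.
move=> k3; rewrite /return_defect big_split/= sum_eq_undup sumrN.
have k1 : (0 : R) < k.-1%:R by rewrite ltr0n; lia.
set u := \sum_(z <- _) _.
have u0 : 0 <= u.
  apply: sumr_ge0 => z _; rewrite /uniform_neighbour; by case: ifP.
have u2 : u <= 2.
  apply: (@le_trans _ _ (\sum_(z <- [seq z <- undup s | (z < k)%N]) (k.-1%:R)^-1)).
    rewrite big_filter big_mkcond/=; apply: ler_sum => z _.
    rewrite /uniform_neighbour; case: ltnP => //= _; by case: ifP.
  rewrite big_const_seq count_predT iter_addr_0 -[_ *+ _]mulr_natl ler_pdivrMr//.
  rewrite -natrM ler_nat (@leq_trans k)//; last by lia.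
  rewrite -[leqRHS](size_iota 0) uniq_leq_size ?filter_uniq ?undup_uniq//.
  by move=> z; rewrite mem_filter mem_iota => /andP[].
have /andP[b0 b1] : 0 <= ((y \in s)%:R : R) <= 1.
  by case: (y \in s); rewrite ?lexx ler01.
rewrite ler_norml; apply/andP; split; lra.
Qed.

(** When all visited vertices are present, each of them except the current one has mass
    [(k - 1)^-1]. *)
Lemma return_defectE (R : realType) (k : nat) (s : seq nat) (y : nat) :
  s != [::] -> {in s, forall z, (z < k)%N} ->
  return_defect R k s y = (y \in s)%:R - (size (undup s)).-1%:R / k.-1%:R.
Proof.
move=> s0 sk; rewrite /return_defect big_split/= sum_eq_undup sumrN.
congr (_ - _); set x := last 0%N s.
have xs : x \in undup s.
  by rewrite mem_undup /x; case: (s) s0 => // a t _; exact: mem_last.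
rewrite (bigD1_seq x)//= ?undup_uniq// {1}/uniform_neighbour eqxx andbF add0r.
rewrite big_seq_cond (eq_bigr (fun=> (k.-1%:R)^-1)); last first.
  move=> z /andP[]; rewrite mem_undup => /sk zk zx.
  by rewrite /uniform_neighbour zk zx.
rewrite -big_seq_cond big_const_seq iter_addr_0 -[_ *+ _]mulr_natl.
congr (_%:R * _); have := count_predC (pred1 x) (undup s).
rewrite count_uniq_mem ?undup_uniq// xs => <-.
by rewrite add1n.
Qed.

Definition past (T : Type) (X : nat -> T -> nat) (n : nat) (w : T) : seq nat :=
  mkseq (X ^~ w) n.+1.

(** The clock enters only through the numbers of vertices present at moves [1] to [n.+1]. This keeps
    the values in a countable type while still fixing the law of jump [n.+1]. *)
Definition history (T : Type) (R : realType) (k0 : nat) (tau : nat -> T -> R)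
    (X : nat -> T -> nat) (n : nat) (w : T) : seq nat * seq nat :=
  (mkseq (fun i => nb_present k0 (move_time tau i.+1 w)) n.+1, past X n w).

Definition step_defect (T : Type) (R : realType) (k0 : nat)
    (tau : nat -> T -> R) (X : nat -> T -> nat) (n : nat) (w : T) : R :=
  return_defect R (nb_present k0 (move_time tau n.+1 w)) (past X n w) (X n.+1 w).

Lemma last_past (T : Type) (X : nat -> T -> nat) n w x :
  last x (past X n w) = X n w.
Proof. by rewrite /past mkseqS last_rcons. Qed.

(** Makes earlier defects constant on the fibers of a later history; [i < j] is what puts position
    [i.+1] in that history. *)
Lemma step_defect_history (T : Type) (R : realType) (k0 : nat)
    (tau : nat -> T -> R) (X : nat -> T -> nat) (i j : nat) (w : T) :
  (i < j)%N ->
  step_defect k0 tau X i w =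
  return_defect R (nth 0%N (history k0 tau X j w).1 i)
    (take i.+1 (history k0 tau X j w).2) (nth 0%N (history k0 tau X j w).2 i.+1).
Proof.
move=> ij; have ij' : (i < j.+1)%N by exact: ltnW.
have -> : take i.+1 (history k0 tau X j w).2 = past X i w.
  by rewrite -map_take take_iota (minn_idPl ij').
have -> : nth 0%N (history k0 tau X j w).2 i.+1 = X i.+1 w by rewrite nth_mkseq.
by rewrite nth_mkseq.
Qed.

(** The sigma-algebra is left arbitrary to serve both for the ambient one and for the one generated
    by the clock and the past. *)
Lemma measurable_history d (T : measurableType d) (R : realType) (k0 : nat)
    (tau : nat -> T -> R) (X : nat -> T -> nat) (n : nat) c :
  (forall i, measurable_fun setT (tau i)) ->
  (forall j k, (j <= n)%N -> measurable [set w | X j w = k]) ->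
  measurable [set w | history k0 tau X n w = c].
Proof.
move=> mtau mX; case: c => ks xs.
rewrite (_ : [set w | _] =
    [set w | mkseq (fun i => nb_present k0 (move_time tau i.+1 w)) n.+1 = ks] `&`
    [set w | mkseq (X ^~ w) n.+1 = xs]); last first.
  by apply/seteqP; split => w; [case=> <- <-|case=> /= <- <-].
apply: measurableI.
  apply: (@measurable_mkseq_fiber _ _
    (fun i w => nb_present k0 (move_time tau i.+1 w))) => i k _.
  by apply: measurable_nb_present; exact: measurable_sum.
by apply: measurable_mkseq_fiber => i k; exact: mX.
Qed.

Lemma measurable_fun_nat_fiber d (T : measurableType d) (X : T -> nat) k :
  measurable_fun setT X -> measurable [set w | X w = k].
Proof. by move=> mX; rewrite -[X in measurable X]setTI; exact: (mX _ [set k]). Qed.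

(** * Orthogonality of the defects and almost sure presence of the positions *)

Section walk.
Context d (Omega : measurableType d) (R : realType) (P : probability Omega R).
Variables (k0 : nat) (lambda : R) (x0 : nat).
Variables (tau : nat -> {RV P >-> R}) (X : nat -> {RV P >-> nat}).
Hypothesis k0_ge3 : (3 <= k0)%N.
Hypothesis walk : growing_walk k0 lambda x0 tau X.

Let Y := step_defect k0 tau X.

(** Generators of [clock_and_past tau X n], named to turn the generated sigma-algebra into a
    measurable type. *)
Let clock_gen n : set (set Omega) := [set E |
  (exists i (B : set R), measurable B /\ E = tau i @^-1` B) \/
  (exists j (C : set nat), (j <= n)%N /\ E = X j @^-1` C)].

Let measurable_clock n i :
  measurable_fun [set: g_sigma_algebraType (clock_gen n)] (tau i).
Proof.
move=> _ B mB; rewrite setTI; apply: sub_sigma_algebra.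
by left; exists i, B.
Qed.

Lemma clock_history n c :
  clock_and_past tau X n [set w | history k0 tau X n w = c].
Proof.
apply: (@measurable_history _ (g_sigma_algebraType (clock_gen n)) R k0 tau X n c).
  exact: measurable_clock.
move=> j k jn; apply: sub_sigma_algebra.
by right; exists j, [set k].
Qed.

Lemma clock_nb_present n m k :
  clock_and_past tau X n [set w | nb_present k0 (move_time tau m w) = k].
Proof.
apply: (@measurable_nb_present _ (g_sigma_algebraType (clock_gen n)) R k0 k).
by apply: measurable_sum => i; exact: measurable_clock.
Qed.

Lemma measurable_history_walk n c :
  measurable [set w | history k0 tau X n w = c].
Proof.
apply: measurable_history => [i|j k _]; first exact: measurable_funPT.
by apply: measurable_fun_nat_fiber; exact: measurable_funPT.
Qed.

Lemma measurable_step_defect n : measurable_fun setT (Y n).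
Proof.
rewrite (_ : Y n = (fun c : seq nat * seq nat => return_defect R (nth 0%N c.1 n)
    (take n.+1 c.2) (nth 0%N c.2 n.+1)) \o history k0 tau X n.+1).
  by apply: measurable_fun_fibers => c; exact: measurable_history_walk.
by apply/funext => w; rewrite /Y (@step_defect_history _ _ _ _ _ n n.+1).
Qed.

Lemma step_defect_bounded n w : `|Y n w| <= 2.
Proof. by apply: return_defect_bounded; rewrite (leq_trans k0_ge3)// leq_addr. Qed.

Lemma Lfun2_step_defect n : Y n \in Lfun P 2%:E.
Proof.
apply: Lfun2_of_bounded (step_defect_bounded n); exact: measurable_step_defect.
Qed.

(** On a fiber the current position and the number of present vertices are constant, so the defect
    is a finite sum of indicators minus the constants that [gw_jump] assigns to them as conditional
    probabilities. *)
Lemma integral_step_defect n c :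
  (\int[P]_(w in [set w | history k0 tau X n w = c]) (Y n w)%:E = 0)%E.
Proof.
set E := [set w | _].
have mE : measurable E by exact: measurable_history_walk.
pose k := nth 0%N c.1 n.
pose u z := uniform_neighbour R k (last 0%N c.2) z.
have EP w : E w -> [/\ nb_present k0 (move_time tau n.+1 w) = k,
    past X n w = c.2 & X n w = last 0%N c.2].
  move=> Ew; rewrite /k -Ew /= nth_mkseq// -(last_past X n w 0%N).
  by split.
rewrite (eq_integral (fun w =>
    (\sum_(z <- undup c.2) ((\1_(X n.+1 @^-1` [set z]) w)%:E - (u z)%:E)))%E); last first.
  move=> w; rewrite inE => /EP[kE pE _].
  rewrite /Y /step_defect /return_defect kE pE -sumEFin.
  apply: eq_bigr => z _; rewrite -EFinB; congr (_ - _)%:E.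
  rewrite indicE (_ : (w \in _) = (X n.+1 w == z))//.
  by apply/idP/eqP; rewrite inE.
have mXz z : measurable (X n.+1 @^-1` [set z]).
  by apply: measurable_fun_nat_fiber; exact: measurable_funPT.
have i1 z : P.-integrable E (EFin \o \1_(X n.+1 @^-1` [set z])).
  exact: integrableS (integrable_indic P (mXz z)).
have i2 z : P.-integrable E (EFin \o cst (u z)).
  exact: finite_measure_integrable_cst.
rewrite integral_sum//; last by move=> z; exact: (integrableB mE (i1 z) (i2 z)).
apply: big1 => z _.
have J : P (E `&` X n.+1 @^-1` [set z]) = (\int[P]_(w in E) (u z)%:E)%E.
  apply: (eq_trans (gw_jump walk z (@clock_history n c))).
  by apply: eq_integral => w; rewrite inE => /EP[-> _ ->].
rewrite (integralB mE (i1 z) (i2 z))/= integral_indic// setIC.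
apply: (eq_trans (congr1 (fun a => a - _)%E J)).
by rewrite subee// integral_cst// fin_numM// fin_num_measure.
Qed.

(** On a fiber of the history at [j] the factor [Y i] is constant and [Y j] integrates to 0. *)
Lemma expectation_step_defect_mul i j : (i < j)%N -> 'E_P[Y i \* Y j]%E = 0%E.
Proof.
move=> ij; rewrite unlock.
pose f (c : seq nat * seq nat) := return_defect R (nth 0%N c.1 i)
  (take i.+1 c.2) (nth 0%N c.2 i.+1).
have YE w : Y i w = f (history k0 tau X j w) by exact: step_defect_history.
rewrite (_ : (fun w => _) = fun w => (f (history k0 tau X j w) * Y j w)%:E); last first.
  by apply/funext => w /=; rewrite YE.
apply: integral_mul_fibers_eq0.
- by move=> c; exact: measurable_history_walk.
- rewrite (_ : (fun w => _) = Y i \* Y j); last first.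
    by apply/funext => w /=; rewrite YE.
  by apply/Lfun1_integrable; apply: Lfun2_mul_Lfun1; exact: Lfun2_step_defect.
- apply/Lfun1_integrable; apply: Lfun_subset12; last exact: Lfun2_step_defect.
  exact: fin_num_measure.
- exact: integral_step_defect.
Qed.

Lemma ae_cvg_mean_step_defect :
  {ae P, forall w, (\sum_(i < n) Y i w) / n%:R @[n --> \oo] --> (0 : R)}.
Proof.
(* Both constants come from [|Y n w| <= 2]: 4 bounds the second moments and [- 2] is the lower
   bound. *)
apply: (@ae_cvg_mean_orthogonal _ _ _ P Y 4 2) => //.
- exact: Lfun2_step_defect.
- exact: expectation_step_defect_mul.
- move=> n; rewrite -[leRHS](expectation_cst P); apply: expectation_le => //.
  + by apply: measurable_funM; exact: measurable_step_defect.
  + by move=> w /=; rewrite -expr2 sqr_ge0.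
  + apply: aeW => w /=; rewrite -expr2 -real_normK ?num_real//.
    have := step_defect_bounded n w; have := normr_ge0 (Y n w); nra.
- by move=> n w; have := step_defect_bounded n w; rewrite ler_norml => /andP[].
Qed.

(** For each pair [k <= y], a jump to [y] with [k] vertices present has probability 0, and there are
    countably many pairs. *)
Lemma ae_position_present :
  {ae P, forall w, forall n, (X n w < nb_present k0 (move_time tau n w))%N}.
Proof.
apply: ae_foralln => -[|n].
  apply: aeW => w; rewrite (gw_start walk) (leq_trans (gw_start_present walk))//.
  exact: leq_addr.
have : {ae P, forall w, forall k y, (k <= y)%N ->
    ~ (nb_present k0 (move_time tau n.+1 w) = k /\ X n.+1 w = y)}.
  apply: ae_foralln => k; apply: ae_foralln => y.
  pose E := [set w | nb_present k0 (move_time tau n.+1 w) = k].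
  have mE : measurable E.
    apply: measurable_nb_present; apply: measurable_sum => i.
    exact: measurable_funPT.
  have mXy : measurable (X n.+1 @^-1` [set y]).
    by apply: measurable_fun_nat_fiber; exact: measurable_funPT.
  have [ky|ky] := leqP k y; last first.
    by apply: aeW.
  exists (E `&` X n.+1 @^-1` [set y]); split.
  - exact: measurableI.
  - apply: (eq_trans (gw_jump walk y (@clock_nb_present n n.+1 k))).
    apply: integral0_eq => w /= ->.
    by rewrite /uniform_neighbour ltnNge ky.
  - by move=> w /= /not_implyP[_ /contrapT].
apply: filterS => w H; rewrite ltnNge; apply/negP => h.
by exact: (H _ (X n.+1 w) h).
Qed.

End walk.

(** * Analysis of a single trajectory *)

Lemma size_undup_rcons (T : eqType) (s : seq T) (x : T) :
  size (undup (rcons s x)) = (size (undup s) + (x \notin s))%N.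
Proof.
rewrite undup_rcons size_rcons; have [xs|xs] := boolP (x \in s).
  rewrite -(rem_filter x (undup_uniq s)) size_rem ?mem_undup// addn0 prednK//.
  by rewrite -has_predT; apply/hasP; exists x; rewrite ?mem_undup.
rewrite addn1; congr (size _).+1; apply/all_filterP/allP => y.
by rewrite mem_undup; apply: contraL => /eqP ->.
Qed.

Section trajectory.
Variables (T : Type) (R : realType) (k0 : nat) (lambda : R).
Variables (tau : nat -> T -> R) (X : nat -> T -> nat) (w : T).
Hypotheses (k0_ge3 : (3 <= k0)%N) (lambda_gt0 : 0 < lambda).
Hypothesis tau_gt0 : forall i, 0 < tau i w.
Hypothesis X_lt : forall n, (X n w < nb_present k0 (move_time tau n w))%N.
Hypothesis cvg_move_time :
  move_time tau n w / n%:R @[n --> \oo] --> lambda^-1.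
Hypothesis cvg_defect :
  (\sum_(i < n) step_defect k0 tau X i w) / n%:R @[n --> \oo] --> (0 : R).

Let S n := move_time tau n w.
Let D n := size (undup (past X n w)).

Let S_homo : {homo S : i j / (i <= j)%N >-> i <= j}.
Proof.
move=> i j /subnK <-; elim: (j - i)%N => [//|k ih].
by rewrite addSn (le_trans ih)// /S /move_time big_ord_recr/= lerDl ltW.
Qed.

Let S_ge0 n : 0 <= S n.
Proof. by apply: sumr_ge0 => i _; exact: ltW. Qed.

(** An instance of [cvg_coverage]: [k n] counts the possible targets of move [n.+1] and [M n] sums
    the first [n] defects. *)
Lemma cvg_distinct_positions : (D n)%:R / n%:R @[n --> \oo] --> (1 + lambda)^-1.
Proof.
pose K n := nb_present k0 (S n).
have K3 n : (3 <= K n)%N by rewrite (leq_trans k0_ge3)// leq_addr.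
have K_homo i j : (i <= j)%N -> (K i <= K j)%N.
  by move=> ij; rewrite leq_add2l; apply: le_truncn; exact: S_homo.
apply: (@cvg_coverage _ _ (fun n => (K n.+1).-1%:R)
  (fun n => \sum_(i < n) step_defect k0 tau X i w)) => //.
- by move=> n; rewrite ler1n; have := K3 n.+1; lia.
- have kl : (K n.+1).-1%:R / n%:R @[n --> \oo] --> lambda^-1.
    have cst0 (a : R) : a / n%:R @[n --> \oo] --> 0.
      rewrite -(mulr0 a); apply: cvgM; first exact: cvg_cst.
      rewrite -(cvg_shiftS (fun n => n%:R^-1 : R)); exact: cvg_harmonic.
    (* Truncation and [k0 >= 3] place [(K n.+1).-1] between [S n.+1] and [S n.+1 + k0]. *)
    apply: (@squeeze_cvgr _ _ _ _ (fun n => S n.+1 / n%:R)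
      (fun n => S n.+1 / n%:R + k0%:R / n%:R)).
    + near=> n; have /andP[h1 h2] := truncn_itv (S_ge0 n.+1).
      rewrite -mulrDl !ler_wpM2r ?invr_ge0 ?ler0n//.
        rewrite (le_trans _ (lerD h1 (lexx _)))// -natrD ler_nat /K /nb_present.
        by lia.
      rewrite (le_trans (ltW h2))// ler_nat /K /nb_present.
      by have := k0_ge3; lia.
    + exact: cvg_mean_shiftS.
    + rewrite -[lambda^-1]addr0; apply: cvgD; last exact: cst0.
      exact: cvg_mean_shiftS.
  rewrite -[lambda]invrK.
  have H : ((K n.+1).-1%:R / n%:R)^-1 @[n --> \oo] --> lambda^-1^-1.
    by apply: cvgV => //; rewrite invr_eq0 gt_eqF.
  by apply: cvg_trans H; apply: near_eq_cvg; apply: nearW => n; rewrite invf_div.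
(* A move adds to [D] one minus the return indicator, which is its conditional probability plus the
   defect. *)
- move=> n; rewrite big_ord_recr/= {2}/step_defect return_defectE//; last first.
    move=> z /mapP[i]; rewrite mem_iota add0n => /andP[_ iln] ->.
    by rewrite (leq_trans (X_lt i))// K_homo// ltnW.
  rewrite /D {1}/past mkseqS size_undup_rcons -/(past X n w) natrD.
  have D0 : (0 < size (undup (past X n w)))%N.
    by rewrite -has_predT; apply/hasP; exists (X n w) => //;
      rewrite mem_undup; apply: (map_f (X ^~ w)); rewrite mem_iota add0n ltnSn.
  rewrite -(subn1 (size _)) natrB//.
  have -> : (X n.+1 w \notin past X n w)%:R =
      1 - (X n.+1 w \in past X n w)%:R :> R.
    by case: (_ \in _); rewrite ?subrr ?subr0.
  ring.
Unshelve. all: by end_near. Qed.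

(** With [m T] the number of moves up to [T], the visited vertices are those of [past X (m T)];
    [cvg_inverse_index] passes from moves to time. *)
Lemma cvg_nb_visited :
  (nb_visited tau X n w)%:R / n%:R @[n --> \oo] --> lambda / (1 + lambda).
Proof.
have exS (n : nat) : exists k, n%:R < S k.
  (* [S k / k] eventually exceeds half its limit, so [S] is unbounded. *)
  have l2 : 0 < lambda^-1 / 2 by rewrite divr_gt0 ?invr_gt0.
  have [N _ NP] : \forall k \near \oo, lambda^-1 / 2 < S k / k%:R.
    move/cvgr_gt : cvg_move_time; apply.
    by rewrite ltr_pdivrMr// ltr_pMr ?invr_gt0// ltr1n.
  pose k := maxn N.+1 (Num.truncn (n%:R / (lambda^-1 / 2))).+1.
  have k0' : (0 < k)%N by rewrite /k leq_max.
  exists k; have /= := NP k; rewrite ltr_pdivlMr ?ltr0n// => h.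
  apply: lt_le_trans (ltW (h _)); last by rewrite /= /k leq_max leqnSn.
  rewrite mulrC -ltr_pdivrMr// (lt_le_trans (truncnS_gt _))// ler_nat.
  by rewrite /k leq_max leqnn orbT.
have exm (n : nat) : exists m, S m <= n%:R < S m.+1.
  (* [m.+1] is the least index whose move time exceeds [n]; it is not 0 because [S 0 = 0]. *)
  case: (ex_minnP (exS n)) => -[|m]; first by rewrite /S /move_time big_ord0 ltrn0.
  move=> h hm; exists m; rewrite h andbT leNgt; apply/negP => /hm.
  by rewrite ltnn.
have /choice[m mP] := exm.
have := cvg_inverse_index lambda_gt0 S_homo cvg_move_time cvg_distinct_positions mP.
apply: cvg_trans; apply: near_eq_cvg; apply: nearW => n.
congr (_%:R / _); rewrite /nb_visited.
(* The visited set is finite here, so [fset_set] does not fall back to the empty set. *)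
rewrite (_ : visited tau X n w = [set` [fset x in past X (m n) w]%fset]).
  by rewrite set_fsetK card_fseq.
have /andP[h1 h2] := mP n.
apply/seteqP; split => v /=.
  move=> [k [kn <-]]; rewrite in_fset; apply/mapP; exists k => //.
  rewrite mem_iota add0n /= ltnNge; apply/negP => mk.
  by have := le_trans (S_homo mk) kn; rewrite leNgt h2.
rewrite in_fset => /mapP[k]; rewrite mem_iota add0n => /andP[_ km] ->.
by exists k; split => //; exact: le_trans (S_homo _) h1.
Qed.

End trajectory.

(** * The almost sure limit, on the intersection of four events of full measure *)

Theorem theorem2p3 (R : realType) (d : measure_display)
    (Omega : measurableType d) (P : probability Omega R)
    (k0 : nat) (lambda : R) (x0 : nat)
    (tau : nat -> {RV P >-> R}) (X : nat -> {RV P >-> nat})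
    (k0_ge3 : (3 <= k0)%N) (lambda_gt0 : 0 < lambda)
    (walk : growing_walk k0 lambda x0 tau X) :
  {ae P, forall w,
    (fun T : nat => (nb_visited tau X T w)%:R / T%:R : R) @ \oo
      --> lambda / (1 + lambda)}.
Proof.
have tau_exp := gw_exponential walk.
have tau_indep := gw_independent walk.
have gt0 := ae_tau_gt0 tau_exp.
have clock := ae_cvg_move_time lambda_gt0 tau_exp tau_indep.
have present := ae_position_present walk.
have defect := ae_cvg_mean_step_defect k0_ge3 walk.
apply: filterS2 (filterI gt0 clock) (filterI present defect).
move=> w [w_gt0 w_clock] [w_present w_defect].
exact: (cvg_nb_visited k0_ge3 lambda_gt0 w_gt0 w_present w_clock w_defect).
Qed.
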